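(* Every real nonnegative terraced symmetric matrix is positive semidefinite.
   Context: For a real symmetric $V\times V$ matrix $C=(c_{vw})$ ($V$ a finite set) and $\ell\in\mathbb{R}$, the superlevel set is $S_\ell(C)=\{(v,w)\in V\times V : c_{vw}\ge \ell\}$. The matrix $C$ is called terraced if for each $\ell\in\mathbb{R}$ there is a set $\mathcal{T}(\ell)$ of pairwise disjoint subsets of $V$ such that $S_\ell(C)=\bigcup_{X\in\mathcal{T}(\ell)} X\times X$. *)

(* Defs.v *)
From mathcomp Require Import all_boot all_order all_algebra.
From mathcomp Require Import reals.

Set Implicit Arguments.
Unset Strict Implicit.
Unset Printing Implicit Defensive.

Import Order.TTheory GRing.Theory Num.Theory.
Local Open Scope ring_scope.

(* A V x V matrix, for an arbitrary finite set V, is a function V -> V -> R;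
   the library's 'M[R]_n would force a numbering of V. *)

Definition symmetric_matrix (R : realType) (V : finType) (C : V -> V -> R) : Prop :=
  forall v w : V, C v w = C w v.

Definition nonnegative_matrix (R : realType) (V : finType) (C : V -> V -> R) : Prop :=
  forall v w : V, 0 <= C v w.

Definition superlevel (R : realType) (V : finType) (C : V -> V -> R) (l : R) :
    {set V * V} :=
  [set p : V * V | l <= C p.1 p.2].

Definition terraced (R : realType) (V : finType) (C : V -> V -> R) : Prop :=
  forall l : R, exists T : {set {set V}},
    trivIset T /\ superlevel C l = \bigcup_(X in T) setX X X.

Definition positive_semidefinite (R : realType) (V : finType) (C : V -> V -> R) : Prop :=
  symmetric_matrix C /\
  forall x : V -> R, 0 <= \sum_(v : V) \sum_(w : V) x v * C v w * x w.

(* Main.v *)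
Require Import Defs.
From mathcomp Require Import all_boot all_order all_algebra.
From mathcomp Require Import reals.

(** If [a < b] and no entry of [C] lies strictly between [a] and [b], then
    [max (C - a) 0 = (b - a) 1_(S_b(C)) + max (C - b) 0] entrywise.  Starting at
    [a = 0] and letting [b] run through the positive entries in increasing
    order writes [C] as a nonnegative combination of the indicators of its
    superlevel sets.  The quadratic form of the indicator of a disjoint union of
    squares [X * X] is the sum of squares of the sums of [x] over the sets [X]. *)

Import Order.TTheory GRing.Theory Num.Theory.
Local Open Scope ring_scope.

(** By disjointness at most one [X] in [T] contains [v], so at most one term of the sum is
    nonzero. *)
Lemma indicator_bigcup_squares (R : realType) (V : finType) (T : {set {set V}})
    (v w : V) :
  trivIset T ->
  ((v, w) \in \bigcup_(X in T) setX X X)%:R =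
    \sum_(X in T) (v \in X)%:R * (w \in X)%:R :> R.
Proof.
move=> tT; case: bigcupP => [[X XT] | noX].
  rewrite in_setX => /andP[vX wX].
  rewrite (bigD1 X) //= vX wX mulr1 big1 ?addr0 // => Y /andP[YT YX].
  have [vY|_] := boolP (v \in Y); last by rewrite mul0r.
  by case/eqP: YX; rewrite -(def_pblock tT YT vY) (def_pblock tT XT vX).
rewrite big1 // => X XT.
have [vX|_] := boolP (v \in X); last by rewrite mul0r.
have [wX|_] := boolP (w \in X); last by rewrite mulr0.
by case: noX; exists X; rewrite // in_setX vX.
Qed.

Lemma superlevel_form_ge0 (R : realType) (V : finType) (C : V -> V -> R)
    (l : R) (x : V -> R) :
  terraced C -> 0 <= \sum_v \sum_w x v * (l <= C v w)%R%:R * x w.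
Proof.
move=> /(_ l)[T [tT defT]].
suff -> : \sum_v \sum_w x v * (l <= C v w)%R%:R * x w =
          \sum_(X in T) (\sum_v x v * (v \in X)%:R) ^+ 2.
  by apply: sumr_ge0 => X _; apply: sqr_ge0.
(* Each square becomes a double sum, and the sum over [X] is moved innermost, so that the two sides
   can be compared for fixed [v] and [w]. *)
under [RHS]eq_bigr do rewrite expr2 mulr_suml.
rewrite [RHS]exchange_big; apply: eq_bigr => v _.
under [RHS]eq_bigr do rewrite mulr_sumr.
rewrite [RHS]exchange_big; apply: eq_bigr => w _ /=.
have -> : (l <= C v w) = ((v, w) \in superlevel C l) by rewrite inE.
rewrite defT indicator_bigcup_squares // mulr_sumr mulr_suml.
by apply: eq_bigr => X _; rewrite mulrA mulrAC -!mulrA [x w * _]mulrC mulrCA !mulrA.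
Qed.

(** Induction on [s] with [a] varying: each step splits off the superlevel set of the least level
    [b] and restarts from [b]. *)
Lemma truncated_form_ge0 (R : realType) (V : finType) (C : V -> V -> R)
    (x : V -> R) (s : seq R) (a : R) :
  terraced C -> path <%R a s -> (forall v w, a < C v w -> C v w \in s) ->
  0 <= \sum_v \sum_w x v * Num.max (C v w - a) 0 * x w.
Proof.
move=> tC; elim: s a => [|b s IHs] a /=.
  move=> _ Ca; rewrite big1 // => v _; rewrite big1 // => w _.
  have [aC|Ca'] := ltP a (C v w); first by have := Ca v w aC.
  by rewrite max_r ?subr_le0 // mulr0 mul0r.
case/andP=> ab bs Ca.
have b_le c : c \in b :: s -> b <= c.
  rewrite inE => /predU1P[-> //|cs].
  by apply/ltW/(allP (order_path_min lt_trans bs)).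
have split_max v w : Num.max (C v w - a) 0 =
    (b - a) * (b <= C v w)%R%:R + Num.max (C v w - b) 0.
  have [bC|Cb] := leP b (C v w).
    rewrite mulr1 !max_l ?subr_ge0 ?(le_trans (ltW ab)) //.
    by rewrite [RHS]addrC addrA subrK.
  (* An entry above [a] lies in [b :: s], whose least element is [b]. *)
  have Cle : C v w <= a.
    by rewrite leNgt; apply/negP => /Ca/b_le; rewrite leNgt Cb.
  by rewrite mulr0 add0r !max_r // subr_le0 // ltW.
under eq_bigr do under eq_bigr do
  rewrite split_max mulrDr mulrDl mulrCA -(mulrA (b - a)).
under eq_bigr do rewrite big_split -mulr_sumr /=.
rewrite big_split -mulr_sumr /= addr_ge0 //.
  by rewrite mulr_ge0 ?superlevel_form_ge0 // subr_ge0 ltW.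
apply: IHs => // v w bC.
by have := Ca v w (lt_trans ab bC); rewrite inE gt_eqF.
Qed.

Theorem theorem4 (R : realType) (V : finType) (C : V -> V -> R)
    (C_symmetric : symmetric_matrix C)
    (C_nonnegative : nonnegative_matrix C)
    (C_terraced : terraced C) :
  positive_semidefinite C.
Proof.
split=> // x.
(* Removing duplicates makes the sorted list strictly increasing; keeping only positive entries lets
   the path start at 0. *)
pose s := sort <=%R (undup [seq c <- [seq C p.1 p.2 | p : V * V] | 0 < c]).
have mem_s c : (c \in s) = (0 < c) && (c \in [seq C p.1 p.2 | p : V * V]).
  by rewrite mem_sort mem_undup mem_filter.
have s_path : path <%R 0 s.
  rewrite path_sortedE; last exact: lt_trans.
  rewrite sort_lt_sorted undup_uniq andbT.
  by apply/allP => c; rewrite mem_s => /andP[].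
have s_entries v w : 0 < C v w -> C v w \in s.
  by move=> C0; rewrite mem_s C0; apply: (image_f (fun p => C p.1 p.2) (x := (v, w))).
have := truncated_form_ge0 R V C x s 0 C_terraced s_path s_entries.
(* Nonnegativity makes the truncation at 0 equal to [C] itself. *)
by under eq_bigr do under eq_bigr do rewrite subr0 max_l ?C_nonnegative //.
Qed.
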